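(* Let $\mathcal{E}$ be a locally Cartesian closed category, $M:\mathcal{E}\to\mathcal{E}$ a monad, and $(\mathbb{T},+,0)$ a monoid in $\mathcal{E}$. The categories $\mathbf{Coalg}_M^{\mathbb{T}}(p)$ of $pM$-coalgebras with time $\mathbb{T}$ extend to an opindexed category $\mathbf{Coalg}_M^{\mathbb{T}}(-):\mathbf{Poly}_{\mathcal{E}}\to\mathbf{Cat}$, as follows. For a morphism of polynomials $\varphi=(\varphi_1,\varphi^\#):p\to q$, the functor $\mathbf{Coalg}_M^{\mathbb{T}}(\varphi):\mathbf{Coalg}_M^{\mathbb{T}}(p)\to\mathbf{Coalg}_M^{\mathbb{T}}(q)$ sends an object $(X,\vartheta^o,\vartheta^u)$ to $(X,\ \varphi_1\circ\vartheta^o,\ \vartheta^u\circ{\vartheta^o}^*\varphi^\#)$, where the two maps are the composites $$\mathbb{T}\times X\xrightarrow{\vartheta^o}p(1)\xrightarrow{\varphi_1}q(1),\qquad \sum_{t:\mathbb{T}}\sum_{x:X}q[\varphi_1\circ\vartheta^o(t,x)]\xrightarrow{{\vartheta^o}^*\varphi^\#}\sum_{t:\mathbb{T}}\sum_{x:X}p[\vartheta^o(t,x)]\xrightarrow{\vartheta^u}MX ,$$ and sends a morphism $f:(X,\vartheta^o,\vartheta^u)\to(Y,\psi^o,\psi^u)$ to the morphism with the same underlying map $f:X\to Y$ of state spaces.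
   Context: $\mathcal{E}$ is thought of as concrete (e.g. $\mathbf{Set}$), and element notation is used. A polynomial in $\mathcal{E}$ is a coproduct of representables $p=\sum_{i:p(1)}y^{p[i]}$, where $y^A=\mathcal{E}(A,-)$; equivalently it is a bundle $\sum_{i:p(1)}p[i]\to p(1)$ in $\mathcal{E}$ with fibres $p[i]$. $\mathbf{Poly}_{\mathcal{E}}$ is the category of polynomials and natural transformations; a morphism $\varphi:p\to q$ is equivalently a pair of a forwards map $\varphi_1:p(1)\to q(1)$ and a family of backwards maps $\varphi^\#_i:q[\varphi_1(i)]\to p[i]$ for $i:p(1)$, and the composite of $\varphi:p\to q$ with $\chi:q\to r$ has forwards map $\chi_1\circ\varphi_1$ and backwards maps $\varphi^\#_i\circ\chi^\#_{\varphi_1(i)}$. A section of $p$ is a section $\sigma:p(1)\to\sum_{i}p[i]$ of the bundle. $\mathbf{B}\mathbb{T}$ is the one-object category (delooping) of $\mathbb{T}$, and $\mathcal{K}\ell(M)$ is the Kleisli category of $M$. Objects of $\mathbf{Coalg}_M^{\mathbb{T}}(p)$ ($pM$-coalgebras with time $\mathbb{T}$) are triples $\vartheta=(S,\vartheta^o,\vartheta^u)$ with $S:\mathcal{E}$, $\vartheta^o:\mathbb{T}\times S\to p(1)$ and $\vartheta^u:\sum_{t:\mathbb{T}}\sum_{s:S}p[\vartheta^o(t,s)]\to MS$, such that for every section $\sigma$ of $p$ the closure $\vartheta^\sigma(t):=\vartheta^u(t)\circ\vartheta^o(t)^*\sigma:S\to MS$ constitutes an object of $\mathbf{Cat}(\mathbf{B}\mathbb{T},\mathcal{K}\ell(M))$;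 that is, $\vartheta^\sigma(0)=\eta_S$ and $\vartheta^\sigma(s+t)$ is the Kleisli composite of $\vartheta^\sigma(s)$ after $\vartheta^\sigma(t)$. Here $\vartheta^o(t)^*\sigma:S\to\sum_{s:S}p[\vartheta^o(t,s)]$ is $s\mapsto(s,\sigma(\vartheta^o(t,s)))$. Morphisms $(X,\vartheta^o,\vartheta^u)\to(Y,\psi^o,\psi^u)$ are maps $f:X\to Y$ in $\mathcal{E}$ with $Mf\circ\vartheta^\sigma(t)=\psi^\sigma(t)\circ f$ for all $t:\mathbb{T}$ and all sections $\sigma$ of $p$; identities and composition are as in $\mathcal{E}$. *)

(* Defs.v *)
From Stdlib Require Import ProofIrrelevance.

Set Implicit Arguments.
Unset Strict Implicit.
Unset Printing Implicit Defensive.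

Record Category := MkCategory {
  Ob :> Type;
  Hom : Ob -> Ob -> Type;
  idm : forall a, Hom a a;
  comp : forall a b c, Hom b c -> Hom a b -> Hom a c;
  comp_idl : forall a b (f : Hom a b), comp (idm b) f = f;
  comp_idr : forall a b (f : Hom a b), comp f (idm a) = f;
  comp_assoc : forall a b c d (h : Hom c d) (g : Hom b c) (f : Hom a b),
    comp h (comp g f) = comp (comp h g) f
}.
Arguments Hom {c} _ _ : rename.
Arguments idm {c} _ : rename.
Arguments comp {c a b c0} _ _ : rename.
Arguments comp_idl {c a b} _ : rename.
Arguments comp_idr {c a b} _ : rename.
Arguments comp_assoc {c a b c0 d} _ _ _ : rename.

Declare Scope cat_scope.
Delimit Scope cat_scope with cat.
Open Scope cat_scope.
Notation "g \o f" := (comp g f) (at level 40, left associativity) : cat_scope.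

(** Equality of arrows whose endpoints are not definitionally equal. *)
Inductive same_arrow (C : Category) (a b : C) (f : Hom a b) :
    forall c d : C, Hom c d -> Prop :=
  same_arrow_refl : same_arrow f f.

Record Functor (C D : Category) := MkFunctor {
  fob :> C -> D;
  fmap : forall a b, Hom a b -> Hom (fob a) (fob b);
  fmap_id : forall a, fmap (idm a) = idm (fob a);
  fmap_comp : forall a b c (g : Hom b c) (f : Hom a b),
    fmap (g \o f) = fmap g \o fmap f
}.
Arguments fmap {C D} f {a b} _ : rename.
Arguments fmap_id {C D} f a : rename.
Arguments fmap_comp {C D} f {a b c} _ _ : rename.

Definition functor_id (C : Category) : Functor C C :=
  MkFunctor (fob := fun a => a) (fmap := fun a b f => f)
    (fun a => eq_refl) (fun a b c g f => eq_refl).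

Lemma functor_comp_id (C D K : Category) (G : Functor D K) (F : Functor C D) (a : C) :
  fmap G (fmap F (idm a)) = idm (G (F a)).
Proof. rewrite fmap_id. apply fmap_id. Qed.

Lemma functor_comp_comp (C D K : Category) (G : Functor D K) (F : Functor C D)
    (a b c : C) (g : Hom b c) (f : Hom a b) :
  fmap G (fmap F (g \o f)) = fmap G (fmap F g) \o fmap G (fmap F f).
Proof. rewrite fmap_comp. apply fmap_comp. Qed.

Definition functor_comp (C D K : Category) (G : Functor D K) (F : Functor C D) :
    Functor C K :=
  MkFunctor (fob := fun a => G (F a)) (fmap := fun a b f => fmap G (fmap F f))
    (functor_comp_id G F) (functor_comp_comp G F).

(** The arrow part of a (strict) functor [B -> Cat] whose object part is [C];
    the laws are equalities of functors. *)
Record OpindexedExtension (B : Category) (C : B -> Category) := MkOpindexed {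
  push : forall a b : B, Hom a b -> Functor (C a) (C b);
  push_id : forall a, push (idm a) = functor_id (C a);
  push_comp : forall a b c (g : Hom b c) (f : Hom a b),
    push (g \o f) = functor_comp (push g) (push f)
}.
Arguments push {B C} o {a b} _ : rename.

Record Terminal (C : Category) := MkTerminal {
  one : C;
  bang : forall a, Hom a one;
  bang_uniq : forall a (f : Hom a one), f = bang a
}.

Record BinaryProducts (C : Category) := MkProducts {
  cprod : C -> C -> C;
  cpr1 : forall a b, Hom (cprod a b) a;
  cpr2 : forall a b, Hom (cprod a b) b;
  cpair : forall x a b, Hom x a -> Hom x b -> Hom x (cprod a b);
  cpr1_cpair : forall x a b (f : Hom x a) (g : Hom x b), cpr1 a b \o cpair f g = f;
  cpr2_cpair : forall x a b (f : Hom x a) (g : Hom x b), cpr2 a b \o cpair f g = g;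
  cpair_uniq : forall x a b (h : Hom x (cprod a b)),
    h = cpair (cpr1 a b \o h) (cpr2 a b \o h)
}.

(** [expo a b] is the exponential of [b] by [a]. *)
Record CartesianClosed (C : Category) := MkCCC {
  ccc_terminal : Terminal C;
  ccc_products : BinaryProducts C;
  expo : C -> C -> C;
  ev : forall a b, Hom (cprod ccc_products (expo a b) a) b;
  curry : forall x a b, Hom (cprod ccc_products x a) b -> Hom x (expo a b);
  ev_curry : forall x a b (f : Hom (cprod ccc_products x a) b),
    ev a b \o cpair ccc_products (curry f \o cpr1 ccc_products x a)
                                (cpr2 ccc_products x a) = f;
  curry_uniq : forall x a b (h : Hom x (expo a b)),
    h = curry (ev a b \o cpair ccc_products (h \o cpr1 ccc_products x a)
                                           (cpr2 ccc_products x a))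
}.

Record SliceOb (C : Category) (B : C) := MkSliceOb {
  sdom : C;
  sarr : Hom sdom B
}.

Record SliceHom (C : Category) (B : C) (x y : SliceOb B) := MkSliceHom {
  smap : Hom (sdom x) (sdom y);
  smap_over : sarr y \o smap = sarr x
}.

Lemma slice_hom_eq (C : Category) (B : C) (x y : SliceOb B) (f g : SliceHom x y) :
  smap f = smap g -> f = g.
Proof.
destruct f as [f Hf], g as [g Hg]; simpl; intros e; subst g.
now rewrite (proof_irrelevance _ Hf Hg).
Qed.

Definition slice_id (C : Category) (B : C) (x : SliceOb B) : SliceHom x x :=
  MkSliceHom (comp_idr (sarr x)).

Lemma slice_comp_over (C : Category) (B : C) (x y z : SliceOb B)
    (g : SliceHom y z) (f : SliceHom x y) :
  sarr z \o (smap g \o smap f) = sarr x.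
Proof. now rewrite comp_assoc, (smap_over g), (smap_over f). Qed.

Definition slice_comp (C : Category) (B : C) (x y z : SliceOb B)
    (g : SliceHom y z) (f : SliceHom x y) : SliceHom x z :=
  MkSliceHom (slice_comp_over g f).

Definition Slice (C : Category) (B : C) : Category.
Proof.
refine (@MkCategory (SliceOb B) (@SliceHom C B) (@slice_id C B) (@slice_comp C B) _ _ _);
  intros; apply slice_hom_eq; simpl.
- apply comp_idl.
- apply comp_idr.
- apply comp_assoc.
Defined.

Record LCCC := MkLCCC {
  lccc_cat :> Category;
  lccc_terminal : Terminal lccc_cat;
  lccc_slice : forall B : lccc_cat, CartesianClosed (Slice B)
}.

(** Pullbacks are the binary products of the slices, and the binary products of
    the category are the pullbacks over the terminal object. *)

Definition slice_products (E : LCCC) (B : E) : BinaryProducts (Slice B) :=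
  ccc_products (lccc_slice B).

Definition cospan_product (E : LCCC) (A D B : E) (f : Hom A B) (g : Hom D B) :
    SliceOb B :=
  cprod (slice_products B) (MkSliceOb f : Slice B) (MkSliceOb g : Slice B).

Definition pb (E : LCCC) (A D B : E) (f : Hom A B) (g : Hom D B) : E :=
  sdom (cospan_product f g).

Definition pb1 (E : LCCC) (A D B : E) (f : Hom A B) (g : Hom D B) : Hom (pb f g) A :=
  smap (cpr1 (slice_products B) (MkSliceOb f) (MkSliceOb g)).

Definition pb2 (E : LCCC) (A D B : E) (f : Hom A B) (g : Hom D B) : Hom (pb f g) D :=
  smap (cpr2 (slice_products B) (MkSliceOb f) (MkSliceOb g)).

Lemma pb_square (E : LCCC) (A D B : E) (f : Hom A B) (g : Hom D B) :
  f \o pb1 f g = g \o pb2 f g.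
Proof.
exact (eq_trans (smap_over (cpr1 (slice_products B) (MkSliceOb f) (MkSliceOb g)))
  (eq_sym (smap_over (cpr2 (slice_products B) (MkSliceOb f) (MkSliceOb g))))).
Qed.

Definition pb_pair_slice (E : LCCC) (X A D B : E) (f : Hom A B) (g : Hom D B)
    (u : Hom X A) (v : Hom X D) (e : f \o u = g \o v) :
    SliceHom (MkSliceOb (g \o v)) (cospan_product f g) :=
  cpair (slice_products B)
    (MkSliceHom (x := MkSliceOb (g \o v)) (y := MkSliceOb f) (smap := u) e
      : @Hom (Slice B) (MkSliceOb (g \o v)) (MkSliceOb f))
    (MkSliceHom (x := MkSliceOb (g \o v)) (y := MkSliceOb g) (smap := v) eq_refl
      : @Hom (Slice B) (MkSliceOb (g \o v)) (MkSliceOb g)).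

Definition pb_pair (E : LCCC) (X A D B : E) (f : Hom A B) (g : Hom D B)
    (u : Hom X A) (v : Hom X D) (e : f \o u = g \o v) : Hom X (pb f g) :=
  smap (pb_pair_slice e).

Lemma pb1_pair (E : LCCC) (X A D B : E) (f : Hom A B) (g : Hom D B)
    (u : Hom X A) (v : Hom X D) (e : f \o u = g \o v) :
  pb1 f g \o pb_pair e = u.
Proof.
exact (f_equal (@smap E B (MkSliceOb (g \o v)) (MkSliceOb f))
  (cpr1_cpair (slice_products B) (x := MkSliceOb (g \o v)) _ _)).
Qed.

Lemma pb2_pair (E : LCCC) (X A D B : E) (f : Hom A B) (g : Hom D B)
    (u : Hom X A) (v : Hom X D) (e : f \o u = g \o v) :
  pb2 f g \o pb_pair e = v.
Proof.
exact (f_equal (@smap E B (MkSliceOb (g \o v)) (MkSliceOb g))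
  (cpr2_cpair (slice_products B) (x := MkSliceOb (g \o v)) _ _)).
Qed.

Lemma pb_ext (E : LCCC) (X A D B : E) (f : Hom A B) (g : Hom D B)
    (h k : Hom X (pb f g)) :
  pb1 f g \o h = pb1 f g \o k -> pb2 f g \o h = pb2 f g \o k -> h = k.
Proof.
intros e1 e2.
pose (P := cospan_product f g).
assert (ek : sarr P \o k = sarr P \o h).
{ assert (eP : sarr P = f \o pb1 f g) by
    exact (eq_sym (smap_over (cpr1 (slice_products B) (MkSliceOb f) (MkSliceOb g)))).
  rewrite eP, <- !comp_assoc. f_equal. exact (eq_sym e1). }
pose (h' := @MkSliceHom E B (MkSliceOb (sarr P \o h)) P h eq_refl).
pose (k' := @MkSliceHom E B (MkSliceOb (sarr P \o h)) P k ek).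
change (smap h' = smap k').
f_equal.
pose (U := @cpair_uniq (Slice B) (slice_products B) (MkSliceOb (sarr P \o h))
  (MkSliceOb f) (MkSliceOb g)).
refine (eq_trans (U h') (eq_trans _ (eq_sym (U k')))).
f_equal; apply slice_hom_eq; assumption.
Qed.

Definition pt (E : LCCC) : E := one (lccc_terminal E).

Definition to_pt (E : LCCC) (A : E) : Hom A (pt E) := bang (lccc_terminal E) A.

Lemma to_pt_eq (E : LCCC) (A : E) (f g : Hom A (pt E)) : f = g.
Proof.
now rewrite (bang_uniq (t := lccc_terminal E) f), (bang_uniq (t := lccc_terminal E) g).
Qed.

Definition times (E : LCCC) (A B : E) : E := pb (to_pt A) (to_pt B).

Definition fst_of (E : LCCC) (A B : E) : Hom (times A B) A := pb1 _ _.

Definition snd_of (E : LCCC) (A B : E) : Hom (times A B) B := pb2 _ _.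

Definition pairing (E : LCCC) (X A B : E) (u : Hom X A) (v : Hom X B) :
    Hom X (times A B) :=
  pb_pair (to_pt_eq (to_pt A \o u) (to_pt B \o v)).

Record Monad (C : Category) := MkMonad {
  monad_functor :> Functor C C;
  eta : forall a : C, Hom a (monad_functor a);
  mu : forall a : C, Hom (monad_functor (monad_functor a)) (monad_functor a);
  eta_natural : forall (a b : C) (f : Hom a b),
    fmap monad_functor f \o eta a = eta b \o f;
  mu_natural : forall (a b : C) (f : Hom a b),
    fmap monad_functor f \o mu a = mu b \o fmap monad_functor (fmap monad_functor f);
  mu_eta : forall a : C, mu a \o eta (monad_functor a) = idm (monad_functor a);
  mu_fmap_eta : forall a : C,
    mu a \o fmap monad_functor (eta a) = idm (monad_functor a);
  mu_mu : forall a : C,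
    mu a \o mu (monad_functor a) = mu a \o fmap monad_functor (mu a)
}.

Definition kleisli_comp (C : Category) (M : Monad C) (a b c : C)
    (g : Hom b (M c)) (f : Hom a (M b)) : Hom a (M c) :=
  mu M c \o fmap M g \o f.

Record MonoidIn (E : LCCC) := MkMonoidIn {
  carrier :> E;
  zero : Hom (pt E) carrier;
  add : Hom (times carrier carrier) carrier;
  add_zero_l : add \o pairing (zero \o to_pt carrier) (idm carrier) = idm carrier;
  add_zero_r : add \o pairing (idm carrier) (zero \o to_pt carrier) = idm carrier;
  add_assoc :
    let fst12 := fst_of (times carrier carrier) carrier in
    let snd12 := snd_of (times carrier carrier) carrier in
    let x := fst_of carrier carrier \o fst12 in
    let y := snd_of carrier carrier \o fst12 in
    let z := snd12 in
    add \o pairing (add \o pairing x y) z = add \o pairing x (add \o pairing y z)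
}.

(** The bundle [bundle p : tot p -> pos p] presents [p]: [pos p] is p(1), [tot p]
    is the sum of all the p[i], and for [g : X -> pos p] the object
    [pb g (bundle p)] is the sum over x : X of p[g x]. *)
Record Polynomial (E : LCCC) := MkPolynomial {
  pos : E;
  tot : E;
  bundle : Hom tot pos
}.

Record PolyHom (E : LCCC) (p q : Polynomial E) := MkPolyHom {
  fwd : Hom (pos p) (pos q);
  bwd : Hom (pb fwd (bundle q)) (tot p);
  bwd_over : bundle p \o bwd = pb1 fwd (bundle q)
}.

Lemma family_change_eq (E : LCCC) (p : Polynomial E) (X Y : E)
    (g : Hom Y (pos p)) (h : Hom X Y) :
  g \o (h \o pb1 (g \o h) (bundle p)) = bundle p \o pb2 (g \o h) (bundle p).
Proof. rewrite comp_assoc. apply pb_square. Qed.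

(** (x, a) |-> (h x, a), from the sum of the p[g (h x)] to the sum of the p[g y]. *)
Definition family_change (E : LCCC) (p : Polynomial E) (X Y : E)
    (g : Hom Y (pos p)) (h : Hom X Y) :
    Hom (pb (g \o h) (bundle p)) (pb g (bundle p)) :=
  pb_pair (family_change_eq g h).

Lemma pull_bwd_eq (E : LCCC) (p q : Polynomial E) (phi : PolyHom p q) (X : E)
    (g : Hom X (pos p)) :
  g \o pb1 (fwd phi \o g) (bundle q)
  = bundle p \o (bwd phi \o family_change (fwd phi) g).
Proof.
rewrite comp_assoc, bwd_over.
unfold family_change. now rewrite pb1_pair.
Qed.

(** The pullback of the backwards maps of [phi] along [g]:
    (x, b) |-> (x, phi^#_(g x) b). *)
Definition pull_bwd (E : LCCC) (p q : Polynomial E) (phi : PolyHom p q) (X : E)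
    (g : Hom X (pos p)) :
    Hom (pb (fwd phi \o g) (bundle q)) (pb g (bundle p)) :=
  pb_pair (pull_bwd_eq phi g).

Definition poly_id_over (E : LCCC) (p : Polynomial E) :
  bundle p \o pb2 (idm (pos p)) (bundle p) = pb1 (idm (pos p)) (bundle p) :=
  eq_trans (eq_sym (pb_square _ _)) (comp_idl _).

Definition poly_id (E : LCCC) (p : Polynomial E) : PolyHom p p :=
  MkPolyHom (poly_id_over p).

Lemma poly_comp_over (E : LCCC) (p q r : Polynomial E)
    (chi : PolyHom q r) (phi : PolyHom p q) :
  bundle p \o (bwd phi \o pull_bwd chi (fwd phi))
  = pb1 (fwd chi \o fwd phi) (bundle r).
Proof. rewrite comp_assoc, bwd_over. apply pb1_pair. Qed.

Definition poly_comp (E : LCCC) (p q r : Polynomial E)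
    (chi : PolyHom q r) (phi : PolyHom p q) : PolyHom p r :=
  MkPolyHom (poly_comp_over chi phi).

Lemma family_cast_eq (E : LCCC) (p : Polynomial E) (X : E) (g h : Hom X (pos p)) :
  g = h -> h \o pb1 g (bundle p) = bundle p \o pb2 g (bundle p).
Proof. intros e; subst h; apply pb_square. Qed.

Lemma poly_hom_eq (E : LCCC) (p q : Polynomial E) (phi psi : PolyHom p q)
    (e : fwd phi = fwd psi) :
  bwd phi = bwd psi \o pb_pair (family_cast_eq e) -> phi = psi.
Proof.
destruct phi as [f b Hb], psi as [f' b' Hb']; simpl in *.
subst f'; intros eb.
assert (ec : pb_pair (family_cast_eq (eq_refl f)) = idm (pb f (bundle q))).
{ apply pb_ext; rewrite ?pb1_pair, ?pb2_pair, comp_idr; reflexivity. }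
rewrite ec, comp_idr in eb; subst b'.
now rewrite (proof_irrelevance _ Hb Hb').
Qed.

Lemma poly_comp_idl (E : LCCC) (p q : Polynomial E) (phi : PolyHom p q) :
  poly_comp (poly_id q) phi = phi.
Proof.
apply (@poly_hom_eq E p q (poly_comp (poly_id q) phi) phi (comp_idl (fwd phi))); simpl.
f_equal. apply pb_ext; unfold pull_bwd; rewrite ?pb1_pair, ?pb2_pair; [reflexivity|].
simpl. apply pb2_pair.
Qed.

Lemma poly_comp_idr (E : LCCC) (p q : Polynomial E) (phi : PolyHom p q) :
  poly_comp phi (poly_id p) = phi.
Proof.
apply (@poly_hom_eq E p q (poly_comp phi (poly_id p)) phi (comp_idr (fwd phi))); simpl.
unfold pull_bwd; rewrite pb2_pair. f_equal.
apply pb_ext; unfold family_change; rewrite ?pb1_pair, ?pb2_pair; [|reflexivity].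
apply comp_idl.
Qed.

Lemma pb1_pair_comp (E : LCCC) (Y X A D B : E) (f : Hom A B) (g : Hom D B)
    (u : Hom X A) (v : Hom X D) (e : f \o u = g \o v) (k : Hom Y X) :
  pb1 f g \o (pb_pair e \o k) = u \o k.
Proof. now rewrite comp_assoc, pb1_pair. Qed.

Lemma pb2_pair_comp (E : LCCC) (Y X A D B : E) (f : Hom A B) (g : Hom D B)
    (u : Hom X A) (v : Hom X D) (e : f \o u = g \o v) (k : Hom Y X) :
  pb2 f g \o (pb_pair e \o k) = v \o k.
Proof. now rewrite comp_assoc, pb2_pair. Qed.

Ltac pb_simpl :=
  unfold pull_bwd, family_change; simpl; unfold pull_bwd, family_change;
  repeat (rewrite <- ?comp_assoc;
          rewrite ?pb1_pair_comp, ?pb2_pair_comp, ?pb1_pair, ?pb2_pair);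
  rewrite <- ?comp_assoc.

Lemma poly_comp_assoc (E : LCCC) (p q r s : Polynomial E) (psi : PolyHom r s)
    (chi : PolyHom q r) (phi : PolyHom p q) :
  poly_comp psi (poly_comp chi phi) = poly_comp (poly_comp psi chi) phi.
Proof.
apply (@poly_hom_eq E p s (poly_comp psi (poly_comp chi phi))
  (poly_comp (poly_comp psi chi) phi)
  (comp_assoc (fwd psi) (fwd chi) (fwd phi))); simpl.
rewrite <- !comp_assoc. f_equal.
apply pb_ext; pb_simpl; [reflexivity|].
f_equal. apply pb_ext; pb_simpl; [reflexivity|].
f_equal. apply pb_ext; pb_simpl; reflexivity.
Qed.

Definition Poly (E : LCCC) : Category :=
  @MkCategory (Polynomial E) (@PolyHom E) (@poly_id E) (@poly_comp E)
    (@poly_comp_idl E) (@poly_comp_idr E) (@poly_comp_assoc E).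

Record PolySection (E : LCCC) (p : Polynomial E) := MkPolySection {
  sect :> Hom (pos p) (tot p);
  sect_over : bundle p \o sect = idm (pos p)
}.

Lemma pull_section_eq (E : LCCC) (p : Polynomial E) (sigma : PolySection p) (X : E)
    (g : Hom X (pos p)) :
  g \o idm X = bundle p \o (sigma \o g).
Proof. now rewrite comp_idr, comp_assoc, sect_over, comp_idl. Qed.

(** x |-> (x, sigma (g x)) *)
Definition pull_section (E : LCCC) (p : Polynomial E) (sigma : PolySection p) (X : E)
    (g : Hom X (pos p)) : Hom X (pb g (bundle p)) :=
  pb_pair (pull_section_eq sigma g).

Record CoalgData (E : LCCC) (M : Monad E) (T : MonoidIn E) (p : Polynomial E) :=
  MkCoalgData {
    state : E;
    out : Hom (times T state) (pos p);
    upd : Hom (pb out (bundle p)) (M state)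
  }.

(** An element t : T is a point [pt E -> T], that is, an arrow of the one-object
    category BT. As [M] carries no strength, the Kleisli composition law below does
    not make sense at generalized elements of T. *)

(** s |-> (t, s) *)
Definition at_time (E : LCCC) (T : MonoidIn E) (t : Hom (pt E) T) (S : E) :
    Hom S (times T S) :=
  pairing (t \o to_pt S) (idm S).

Definition out_at (E : LCCC) (M : Monad E) (T : MonoidIn E) (p : Polynomial E)
    (th : CoalgData M T p) (t : Hom (pt E) T) : Hom (state th) (pos p) :=
  out th \o at_time t (state th).

Definition upd_at (E : LCCC) (M : Monad E) (T : MonoidIn E) (p : Polynomial E)
    (th : CoalgData M T p) (t : Hom (pt E) T) :
    Hom (pb (out_at th t) (bundle p)) (M (state th)) :=
  upd th \o family_change (out th) (at_time t (state th)).

Definition closure (E : LCCC) (M : Monad E) (T : MonoidIn E) (p : Polynomial E)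
    (th : CoalgData M T p) (sigma : PolySection p) (t : Hom (pt E) T) :
    Hom (state th) (M (state th)) :=
  upd_at th t \o pull_section sigma (out_at th t).

Definition is_coalg (E : LCCC) (M : Monad E) (T : MonoidIn E) (p : Polynomial E)
    (th : CoalgData M T p) : Prop :=
  forall sigma : PolySection p,
    closure th sigma (zero T) = eta M (state th) /\
    forall s t : Hom (pt E) T,
      closure th sigma (add T \o pairing s t)
      = kleisli_comp (closure th sigma s) (closure th sigma t).

Record CoalgOb (E : LCCC) (M : Monad E) (T : MonoidIn E) (p : Polynomial E) :=
  MkCoalgOb {
    coalg_data :> CoalgData M T p;
    coalg_law : is_coalg coalg_data
  }.

Record CoalgHom (E : LCCC) (M : Monad E) (T : MonoidIn E) (p : Polynomial E)
    (th ps : CoalgOb M T p) := MkCoalgHom {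
  state_map : Hom (state th) (state ps);
  state_map_law : forall (t : Hom (pt E) T) (sigma : PolySection p),
    fmap M state_map \o closure th sigma t = closure ps sigma t \o state_map
}.

Lemma coalg_hom_eq (E : LCCC) (M : Monad E) (T : MonoidIn E) (p : Polynomial E)
    (th ps : CoalgOb M T p) (f g : CoalgHom th ps) :
  state_map f = state_map g -> f = g.
Proof.
destruct f as [f Hf], g as [g Hg]; simpl; intros e; subst g.
now rewrite (proof_irrelevance _ Hf Hg).
Qed.

Lemma coalg_id_law (E : LCCC) (M : Monad E) (T : MonoidIn E) (p : Polynomial E)
    (th : CoalgOb M T p) (t : Hom (pt E) T) (sigma : PolySection p) :
  fmap M (idm (state th)) \o closure th sigma t
  = closure th sigma t \o idm (state th).
Proof. now rewrite fmap_id, comp_idl, comp_idr. Qed.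

Definition coalg_id (E : LCCC) (M : Monad E) (T : MonoidIn E) (p : Polynomial E)
    (th : CoalgOb M T p) : CoalgHom th th :=
  MkCoalgHom (coalg_id_law th).

Lemma coalg_comp_law (E : LCCC) (M : Monad E) (T : MonoidIn E) (p : Polynomial E)
    (th ps ch : CoalgOb M T p) (g : CoalgHom ps ch) (f : CoalgHom th ps)
    (t : Hom (pt E) T) (sigma : PolySection p) :
  fmap M (state_map g \o state_map f) \o closure th sigma t
  = closure ch sigma t \o (state_map g \o state_map f).
Proof.
now rewrite fmap_comp, <- comp_assoc, state_map_law, comp_assoc, state_map_law, comp_assoc.
Qed.

Definition coalg_comp (E : LCCC) (M : Monad E) (T : MonoidIn E) (p : Polynomial E)
    (th ps ch : CoalgOb M T p) (g : CoalgHom ps ch) (f : CoalgHom th ps) :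
    CoalgHom th ch :=
  MkCoalgHom (coalg_comp_law g f).

Definition Coalg (E : LCCC) (M : Monad E) (T : MonoidIn E) (p : Poly E) : Category.
Proof.
refine (@MkCategory (CoalgOb M T p) (@CoalgHom E M T p)
  (@coalg_id E M T p) (@coalg_comp E M T p) _ _ _);
  intros; apply coalg_hom_eq; simpl.
- apply comp_idl.
- apply comp_idr.
- apply comp_assoc.
Defined.

Definition coalg_push_data (E : LCCC) (M : Monad E) (T : MonoidIn E)
    (p q : Polynomial E) (phi : PolyHom p q) (th : CoalgData M T p) :
    CoalgData M T q :=
  @MkCoalgData E M T q (state th) (fwd phi \o out th)
    (upd th \o pull_bwd phi (out th)).

(* Main.v *)
Require Import Defs.
From Stdlib Require Import ProofIrrelevance FunctionalExtensionality.

Set Implicit Arguments.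
Unset Strict Implicit.
Unset Printing Implicit Defensive.

(** A morphism [phi : p -> q] pulls a section [sigma] of [q] back to the section
    [i |-> phi^#_i (sigma (phi_1 i))] of [p], and the closure of a pushed-forward
    coalgebra by [sigma] is the closure of the original one by the pulled-back
    section. Hence the coalgebra laws and the commutation of morphisms with
    closures for [q] are instances of those for [p]. *)

(** Induction on [same_arrow] needs variable endpoints, so the claim is generalized to arrows
    transported along equalities of endpoints. In the reflexive case these are loops, which proof
    irrelevance collapses to [eq_refl]. *)
Lemma same_arrow_eq (C : Category) (a b : C) (f g : Hom a b) :
  same_arrow f g -> f = g.
Proof.
assert (H : forall (c d : C) (k : Hom c d), same_arrow f k ->
    forall (ea : a = c) (eb : b = d),
    eq_rect a (fun x => Hom x d) (eq_rect b (fun y => Hom a y) f d eb) c ea = k).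
{ intros c d k [] ea eb.
  now rewrite (proof_irrelevance _ ea eq_refl), (proof_irrelevance _ eb eq_refl). }
intros h; exact (H _ _ _ h eq_refl eq_refl).
Qed.

(** Once the object maps are identified by extensionality, both arrow maps have the same type and
    [same_arrow] becomes plain equality; the laws are proofs of propositions. *)
Lemma functor_eq (C D : Category) (F G : Functor C D) :
  (forall a, F a = G a) ->
  (forall (a b : C) (f : Hom a b), same_arrow (fmap F f) (fmap G f)) ->
  F = G.
Proof.
destruct F as [F F1 Fi Fc], G as [G G1 Gi Gc]; simpl; intros eo em.
apply functional_extensionality in eo; subst G.
assert (e : F1 = G1).
{ do 3 (apply functional_extensionality_dep; intro). apply same_arrow_eq, em. }
subst G1.
now rewrite (proof_irrelevance _ Fi Gi), (proof_irrelevance _ Fc Gc).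
Qed.

Section Push.

Variables (E : LCCC) (M : Monad E) (T : MonoidIn E).

(** The domain of the update depends on the output map. The canonical comparison of pullbacks
    replaces a transport along [e], so that the condition can be checked by projections; at
    [eq_refl] it is the identity. *)
Lemma coalg_data_eq (p : Polynomial E) (S : E) (o o' : Hom (times T S) (pos p))
    (u : Hom (pb o (bundle p)) (M S)) (u' : Hom (pb o' (bundle p)) (M S))
    (e : o = o') :
  u = u' \o pb_pair (family_cast_eq e) ->
  MkCoalgData (M := M) u = MkCoalgData (M := M) u'.
Proof.
subst o'; intros ->; f_equal.
refine (eq_trans _ (comp_idr u')); f_equal.
apply pb_ext; rewrite ?pb1_pair, ?pb2_pair, comp_idr; reflexivity.
Qed.

Lemma coalg_ob_eq (p : Polynomial E) (th ps : CoalgOb M T p) :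
  coalg_data th = coalg_data ps -> th = ps.
Proof.
destruct th as [d l], ps as [d' l']; simpl; intros e; subst d'.
now rewrite (proof_irrelevance _ l l').
Qed.

(** State maps determine coalgebra morphisms only between fixed coalgebras, hence the two equalities
    of endpoints. *)
Lemma coalg_hom_same_arrow (p : Poly E) (th th' ps ps' : Coalg M T p)
    (f : Hom th ps) (g : Hom th' ps') :
  th = th' -> ps = ps' -> same_arrow (state_map f) (state_map g) -> same_arrow f g.
Proof.
intros e1 e2; subst th' ps'; intros h.
now rewrite (coalg_hom_eq (same_arrow_eq h)).
Qed.

Lemma section_reindex_over (p q : Polynomial E) (phi : PolyHom p q)
    (sigma : PolySection q) :
  bundle p \o (bwd phi \o pull_section sigma (fwd phi)) = idm (pos p).
Proof. rewrite comp_assoc, bwd_over. apply pb1_pair. Qed.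

Definition section_reindex (p q : Polynomial E) (phi : PolyHom p q)
    (sigma : PolySection q) : PolySection p :=
  MkPolySection (section_reindex_over phi sigma).

Lemma closure_push (p q : Polynomial E) (phi : PolyHom p q) (th : CoalgData M T p)
    (sigma : PolySection q) (t : Hom (pt E) T) :
  closure (coalg_push_data phi th) sigma t = closure th (section_reindex phi sigma) t.
Proof.
unfold closure, upd_at, out_at; simpl.
rewrite <- !comp_assoc; f_equal.
(* Both maps into the sum of the p[i] lie over s |-> (t, s); their directions are [bwd phi] applied
   to maps that agree in the pullback of [bundle q] along [fwd phi]. *)
apply pb_ext; unfold pull_section; pb_simpl; [reflexivity|].
f_equal; apply pb_ext; unfold pull_section; pb_simpl;
  now rewrite ?comp_idr, ?comp_idl.
Qed.

Lemma coalg_push_law (p q : Polynomial E) (phi : PolyHom p q) (th : CoalgOb M T p) :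
  is_coalg (coalg_push_data phi th).
Proof.
intros sigma; destruct (coalg_law th (section_reindex phi sigma)) as [h0 hadd].
split; [|intros s t]; rewrite !closure_push; [exact h0|apply hadd].
Qed.

Definition coalg_push_ob (p q : Polynomial E) (phi : PolyHom p q)
    (th : CoalgOb M T p) : CoalgOb M T q :=
  MkCoalgOb (coalg_push_law phi th).

Lemma coalg_push_hom_law (p q : Polynomial E) (phi : PolyHom p q)
    (th ps : CoalgOb M T p) (f : CoalgHom th ps) (t : Hom (pt E) T)
    (sigma : PolySection q) :
  fmap M (state_map f) \o closure (coalg_push_ob phi th) sigma t
  = closure (coalg_push_ob phi ps) sigma t \o state_map f.
Proof. simpl; rewrite !closure_push; apply state_map_law. Qed.

Definition coalg_push_hom (p q : Polynomial E) (phi : PolyHom p q)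
    (th ps : CoalgOb M T p) (f : CoalgHom th ps) :
    CoalgHom (coalg_push_ob phi th) (coalg_push_ob phi ps) :=
  MkCoalgHom (th := coalg_push_ob phi th) (ps := coalg_push_ob phi ps)
    (coalg_push_hom_law phi f).

Definition coalg_push (p q : Poly E) (phi : Hom p q) :
    Functor (Coalg M T p) (Coalg M T q).
Proof.
refine (@MkFunctor (Coalg M T p) (Coalg M T q) (coalg_push_ob phi)
  (@coalg_push_hom p q phi) _ _); intros; now apply coalg_hom_eq.
Defined.

Lemma coalg_push_data_id (p : Polynomial E) (th : CoalgData M T p) :
  coalg_push_data (poly_id p) th = th.
Proof.
(* The outputs [idm (pos p) \o o] and [o] agree only up to the unit law, along which the updates are
   compared. *)
destruct th as [S o u]; apply (coalg_data_eq (e := comp_idl o)); f_equal.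
apply pb_ext; pb_simpl; reflexivity.
Qed.

Lemma coalg_push_data_comp (p q r : Polynomial E) (chi : PolyHom q r)
    (phi : PolyHom p q) (th : CoalgData M T p) :
  coalg_push_data (poly_comp chi phi) th
  = coalg_push_data chi (coalg_push_data phi th).
Proof.
destruct th as [S o u].
apply (coalg_data_eq (e := eq_sym (comp_assoc (fwd chi) (fwd phi) o))); simpl.
rewrite <- !comp_assoc; f_equal.
(* Three nested pullbacks are compared by projections, over [o], [fwd phi] and [fwd chi]; cancelling
   [bwd phi] and then [bwd chi] leads from each to the next. *)
apply pb_ext; pb_simpl; [reflexivity|].
rewrite <- (comp_assoc (bwd phi)); f_equal; apply pb_ext; pb_simpl; [reflexivity|].
rewrite <- (comp_assoc (bwd chi)); f_equal; apply pb_ext; pb_simpl; [|reflexivity].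
now rewrite <- (comp_assoc (fwd phi)), pb1_pair.
Qed.

Lemma coalg_push_id (p : Poly E) : coalg_push (idm p) = functor_id (Coalg M T p).
Proof.
assert (eo : forall th, coalg_push (idm p) th = th)
  by (intros th; apply coalg_ob_eq, coalg_push_data_id).
apply functor_eq; [exact eo|intros a b f].
(* Pushing forward keeps state objects and state maps by definition; only the coalgebra structures
   at the endpoints need [eo]. *)
apply coalg_hom_same_arrow; [apply eo|apply eo|apply same_arrow_refl].
Qed.

Lemma coalg_push_comp (p q r : Poly E) (chi : Hom q r) (phi : Hom p q) :
  coalg_push (chi \o phi) = functor_comp (coalg_push chi) (coalg_push phi).
Proof.
assert (eo : forall th, coalg_push (chi \o phi) th = coalg_push chi (coalg_push phi th))
  by (intros th; apply coalg_ob_eq, coalg_push_data_comp).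
apply functor_eq; [exact eo|intros a b f].
apply coalg_hom_same_arrow; [apply eo|apply eo|apply same_arrow_refl].
Qed.

End Push.

Theorem proposition2p12 (E : LCCC) (M : Monad E) (T : MonoidIn E) :
  exists F : OpindexedExtension (Coalg M T),
    forall (p q : Poly E) (phi : Hom p q),
      (forall th : Coalg M T p,
         coalg_data (push F phi th) = coalg_push_data phi (coalg_data th)) /\
      (forall (th ps : Coalg M T p) (f : Hom th ps),
         same_arrow (state_map (fmap (push F phi) f)) (state_map f)).
Proof.
exists (MkOpindexed (coalg_push_id M T) (coalg_push_comp M T)).
intros p q phi; split; [reflexivity|intros; apply same_arrow_refl].
Qed.
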